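(* Let $m,n \geq 2$ be integers. The graph $K_m \times K_n$ admits a $C_4$-decomposition if and only if at least one of the following holds: (1) $n \equiv 0 \pmod 4$ and $m$ is odd; (2) $m \equiv 0 \pmod 4$ and $n$ is odd; (3) $m \equiv 1 \pmod 4$ or $n \equiv 1 \pmod 4$.
   Context: All graphs are simple and finite. $K_m$ denotes the complete graph on $m$ vertices and $C_k$ the cycle of length $k$. For graphs $G$ and $H$, the tensor product $G \times H$ has vertex set $V(G)\times V(H)$, with $(g_1,h_1)$ adjacent to $(g_2,h_2)$ iff $g_1g_2 \in E(G)$ and $h_1h_2 \in E(H)$. A graph $G$ admits a $C_k$-decomposition (written $C_k \mid G$) if its edge set can be partitioned into the edge sets of subgraphs each isomorphic to $C_k$. *)

(* Defs.v *)
From mathcomp Require Import all_boot.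

Set Implicit Arguments.
Unset Strict Implicit.
Unset Printing Implicit Defensive.

Record sgraph := SGraph {
  vertex :> finType;
  adj : rel vertex;
  adj_sym : symmetric adj;
  adj_irrefl : irreflexive adj
}.

Definition edges (G : sgraph) : {set {set G}} :=
  [set [set p.1; p.2] | p : G * G & adj p.1 p.2].

Section Complete.
Variable m : nat.

Definition complete_adj : rel 'I_m := fun x y => x != y.

Lemma complete_adj_sym : symmetric complete_adj.
Proof. by move=> x y; rewrite /complete_adj eq_sym. Qed.

Lemma complete_adj_irrefl : irreflexive complete_adj.
Proof. by move=> x; rewrite /complete_adj eqxx. Qed.

Definition complete_graph : sgraph :=
  SGraph complete_adj_sym complete_adj_irrefl.
End Complete.

(* The conjunct [x != y] only matters for k = 1, where it removes the loop;
   [cycle_graph k] is the cycle of length k when k >= 3. *)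
Section Cycle.
Variable k : nat.

Definition cycle_adj : rel 'I_k := fun x y =>
  (x != y) && ((x.+1 %% k == y) || (y.+1 %% k == x)).

Lemma cycle_adj_sym : symmetric cycle_adj.
Proof. by move=> x y; rewrite /cycle_adj eq_sym orbC. Qed.

Lemma cycle_adj_irrefl : irreflexive cycle_adj.
Proof. by move=> x; rewrite /cycle_adj eqxx. Qed.

Definition cycle_graph : sgraph := SGraph cycle_adj_sym cycle_adj_irrefl.
End Cycle.

Section Tensor.
Variables G H : sgraph.

Definition tensor_adj : rel (G * H)%type := fun x y =>
  adj x.1 y.1 && adj x.2 y.2.

Lemma tensor_adj_sym : symmetric tensor_adj.
Proof. by move=> x y; rewrite /tensor_adj (adj_sym x.1) (adj_sym x.2). Qed.

Lemma tensor_adj_irrefl : irreflexive tensor_adj.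
Proof. by move=> x; rewrite /tensor_adj adj_irrefl. Qed.

Definition tensor_product : sgraph := SGraph tensor_adj_sym tensor_adj_irrefl.
End Tensor.

Record subgraph (G : sgraph) := Subgraph {
  sub_vertices : {set G};
  sub_edges : {set {set G}};
  sub_edges_edges : sub_edges \subset edges G;
  sub_edges_vertices : forall e, e \in sub_edges -> e \subset sub_vertices
}.

Definition subgraph_iso (G : sgraph) (S : subgraph G) (F : sgraph) : Prop :=
  exists f : F -> G,
    [/\ injective f,
        [set f x | x : F] = sub_vertices S
      & forall x y : F, adj x y = ([set f x; f y] \in sub_edges S)].

Definition cycle_decomposition (k : nat) (G : sgraph) : Prop :=
  exists P : {set {set {set G}}},
    partition P (edges G) /\
    forall B, B \in P ->
      exists2 S : subgraph G, subgraph_iso S (cycle_graph k) & sub_edges S = B.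

(* Main.v *)
(**
  Necessity: all vertices have degree (m-1)(n-1), which must be even, and the
  number mn(m-1)(n-1)/2 of edges must be divisible by 4.

  Sufficiency: C4 x K2 is a disjoint union of two 4-cycles, so a graph that
  decomposes into 4-cycles still does after tensoring with a complete graph.
  Complete bipartite graphs with even parts decompose into 4-cycles. Up to such
  graphs, K_m with m = 1 mod 4 is a union of K_5's glued at vertices, K_m with
  m odd a union of triangles, and K_m with m = 0 mod 4 a disjoint union of
  K_4's. This leaves the explicit decompositions of K_5 x K_2 and K_4 x K_3.
*)
Require Import Defs.
From mathcomp Require Import all_boot.
From mathcomp Require Import zify.

Set Implicit Arguments.
Unset Strict Implicit.
Unset Printing Implicit Defensive.

(** * Multigraphs on a type and their decompositions into 4-cycles *)

Definition biadj (T : eqType) (s t : seq T) (x y : T) : bool :=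
  (x \in s) && (y \in t) || (x \in t) && (y \in s).

Definition Kadj (T : eqType) (s : seq T) (x y : T) : bool :=
  [&& x \in s, y \in s & x != y].

Definition tensor (T U : Type) (r : T -> T -> nat) (h : U -> U -> nat)
    (x y : T * U) : nat :=
  r x.1 y.1 * h x.2 y.2.

Definition C4_uniq (T : eqType) (q : T * T * T * T) : bool :=
  let: (a, b, c, d) := q in uniq [:: a; b; c; d].

(** A 4-cycle is K_{2,2} with its diagonal pairs as sides, so the lemmas on [biadj] apply to it. *)
Definition C4_adj (T : eqType) (q : T * T * T * T) : T -> T -> bool :=
  let: (a, b, c, d) := q in biadj [:: a; c] [:: b; d].

Definition C4_map (T U : Type) (f : T -> U) (q : T * T * T * T) :=
  let: (a, b, c, d) := q in (f a, f b, f c, f d).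

(* [r x y] is the multiplicity of the edge [{x, y}] in a multigraph, so that
   edge-disjoint unions become sums. *)
Definition C4_dec (T : eqType) (r : T -> T -> nat) : Prop :=
  exists2 s : seq (T * T * T * T), all (@C4_uniq T) s &
    forall x y, \sum_(q <- s) C4_adj q x y = r x y.

Lemma C4_uniq_sides (T : eqType) (a b c d : T) :
  uniq ([:: a; c] ++ [:: b; d]) = C4_uniq (a, b, c, d).
Proof. by apply: perm_uniq; rewrite /= perm_cons (perm_catCA [:: c] [:: b]). Qed.

(** * Closure properties: sums and transport along maps *)

Section Dec.
Variable T : eqType.
Implicit Types r : T -> T -> nat.

Lemma eq_C4_dec r1 r2 : r1 =2 r2 -> C4_dec r1 -> C4_dec r2.
Proof. by move=> e [s us sE]; exists s => // x y; rewrite sE e. Qed.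

Lemma C4_dec0 r : (forall x y, r x y = 0) -> C4_dec r.
Proof. by move=> r0; exists [::] => // x y; rewrite big_nil r0. Qed.

Lemma C4_dec1 (q : T * T * T * T) : C4_uniq q -> C4_dec (C4_adj q).
Proof. by move=> uq; exists [:: q]; rewrite /= ?uq // => x y; rewrite big_seq1. Qed.

Lemma C4_decD r1 r2 r :
  (forall x y, r x y = r1 x y + r2 x y) -> C4_dec r1 -> C4_dec r2 -> C4_dec r.
Proof.
move=> rE [s us sE] [t ut tE]; exists (s ++ t); first by rewrite all_cat us ut.
by move=> x y; rewrite big_cat sE tE rE.
Qed.

Lemma C4_dec_sum (I : eqType) (s : seq I) (F : I -> T -> T -> nat) :
  (forall i, i \in s -> C4_dec (F i)) ->
  C4_dec (fun x y => \sum_(i <- s) F i x y).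
Proof.
elim: s => [|i s IH] Fs; first by apply: C4_dec0 => x y; rewrite big_nil.
apply: C4_decD (Fs i _) (IH _) => [x y||j js]; rewrite ?big_cons ?mem_head //.
by apply: Fs; rewrite in_cons js orbT.
Qed.

Lemma C4_adj_edges (q : T * T * T * T) : let: (a, b, c, d) := q in
  [&& C4_adj q a b, C4_adj q b c, C4_adj q c d & C4_adj q d a].
Proof.
by case: q => [[[a b] c] d]; rewrite /C4_adj /biadj !inE !eqxx !orbT.
Qed.

Lemma C4_adj_support (s : seq (T * T * T * T)) r q x y :
  (forall x y, \sum_(q <- s) C4_adj q x y = r x y) ->
  q \in s -> C4_adj q x y -> 0 < r x y.
Proof. by move=> sE qs qxy; rewrite -sE (big_rem q) //= qxy. Qed.

(** The cycles are pushed forward along [f]. The first hypothesis makes [f] injective on [A], and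
    gives [y = f (g y)] as soon as [g y] is in [A]; a vertex outside the image of [A] is sent by [g]
    outside [A], where there are no edges. *)
Lemma C4_dec_pull (T' : eqType) r (f : T -> T') (g : T' -> T) (A : pred T) :
  (forall x y, A x -> (f x == y) = (x == g y)) ->
  (forall x y, 0 < r x y -> A x) ->
  C4_dec r -> C4_dec (fun x y => r (g x) (g y)).
Proof.
move=> fg rA [s us sE].
(* Every vertex of a cycle in [s] starts one of its edges, and that edge has positive multiplicity
   in [r]. *)
have sA a b c d : (a, b, c, d) \in s -> [/\ A a, A b, A c & A d].
  move=> qs; have qr u v : C4_adj (a, b, c, d) u v -> A u.
    by move/(C4_adj_support sE qs)/rA.
  by have /and4P[/qr ? /qr ? /qr ? /qr ?] := C4_adj_edges (a, b, c, d).
have fI x y : A x -> A y -> (f x == f y) = (x == y).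
  by move=> Ax Ay; rewrite fg // -(eqP (_ : y == g (f y))) // -fg.
exists (map (C4_map f) s) => [|x y].
  rewrite all_map; apply/allP=> -[[[a b] c] d] qs /=.
  have := allP us _ qs; have [Aa Ab Ac Ad] := sA _ _ _ _ qs.
  by rewrite /= !inE !fI.
rewrite big_map -sE big_seq [RHS]big_seq.
apply: eq_bigr => -[[[a b] c] d] /sA[Aa Ab Ac Ad].
by rewrite /= /biadj !inE ![_ == f _]eq_sym !fg // ![_ == g _]eq_sym.
Qed.

End Dec.

(** * Complete and complete bipartite graphs on duplicate-free lists *)

Section Lists.
Variable T : eqType.
Implicit Types (s t u : seq T).

Lemma mem_uniq_cat s t x : uniq (s ++ t) -> (x \in s) && (x \in t) = false.
Proof.
rewrite cat_uniq => /and3P[_ /hasPn st _]; apply/negbTE/negP => /andP[xs xt].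
by have := st _ xt; rewrite /= xs.
Qed.

Lemma biadj_cat s t u x y : uniq (s ++ t ++ u) ->
  biadj s (t ++ u) x y = biadj s t x y + biadj s u x y :> nat.
Proof.
move=> U; have Utu : uniq (t ++ u) by move: U; rewrite cat_uniq => /and3P[].
(* Uniqueness enters as disjointness: no vertex lies in two of the lists. The rest is a truth
   table. *)
have := (mem_uniq_cat x U, mem_uniq_cat y U,
         mem_uniq_cat x Utu, mem_uniq_cat y Utu).
rewrite /biadj !mem_cat.
move: (x \in s) (x \in t) (x \in u) (y \in s) (y \in t) (y \in u).
by do 6!case=> //=; do 3?case.
Qed.

Lemma Kadj_cat s t x y : uniq (s ++ t) ->
  Kadj (s ++ t) x y = Kadj s x y + Kadj t x y + biadj s t x y :> nat.
Proof.
move=> U; have := (mem_uniq_cat x U, mem_uniq_cat y U).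
rewrite /Kadj /biadj !mem_cat; case: eqVneq => [->|_].
  by move: (y \in s) (y \in t) => [] [] //= -[].
move: (x \in s) (x \in t) (y \in s) (y \in t).
by do 4!case=> //=; case.
Qed.

Lemma biadjC s t x y : biadj s t x y = biadj t s x y.
Proof. by rewrite /biadj orbC. Qed.

Lemma Kadj1 (c x y : T) : Kadj [:: c] x y = false.
Proof.
by rewrite /Kadj !inE; case: eqVneq => [->|//]; case: eqVneq.
Qed.

Lemma uniq_glue (p : seq T) (c : T) s : uniq (p ++ c :: s) ->
  [/\ uniq (p ++ [:: c]), uniq (p ++ s) & uniq (c :: s)].
Proof.
move=> U; split; apply: subseq_uniq U.
- by apply: cat_subseq; rewrite // sub1seq mem_head.
- by apply: cat_subseq; rewrite // subseq_cons.
- exact: suffix_subseq.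
Qed.

(** Two cliques sharing only the vertex [c] have no common edge, and the edges left over join [p] to
    [s]. Gluing at a vertex keeps cliques of odd order while both sides of the bipartite part can be
    even. *)
Lemma Kadj_glue (p : seq T) (c : T) s x y : uniq (p ++ c :: s) ->
  Kadj (p ++ c :: s) x y
  = Kadj (p ++ [:: c]) x y + biadj p s x y + Kadj (c :: s) x y :> nat.
Proof.
move=> U; rewrite Kadj_cat // Kadj_cat; last first.
  by move: U; rewrite -cat1s catA cat_uniq => /andP[].
by rewrite -(cat1s c s) biadj_cat // Kadj1; lia.
Qed.

Lemma C4_dec_biadj2 (a b : T) t : uniq [:: a, b & t] -> ~~ odd (size t) ->
  C4_dec (biadj [:: a; b] t).
Proof.
have [n] := ubnP (size t); elim: n t => // n IH [|c [|d t]] //= sz U ev.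
  by apply: C4_dec0 => x y; rewrite /biadj !in_nil andbF.
(* Splitting two vertices off [t] leaves a K_{2,2}, which is itself a 4-cycle. *)
apply: (@C4_decD _ (C4_adj (a, c, b, d)) (biadj [:: a; b] t)).
- by move=> x y; rewrite -(@biadj_cat [:: a; b] [:: c; d] t).
- apply: C4_dec1; move: U; rewrite /= !inE !negb_or.
  case/and5P=> /and4P[-> -> -> _] /and3P[bc -> _] /andP[-> _] _ _.
  by rewrite eq_sym bc.
- apply: IH; [by lia | | by rewrite negbK in ev].
  move: U; rewrite /= !inE !negb_or.
  by case/and5P=> /and4P[-> _ _ ->] /and3P[_ _ ->] _ _ ->.
Qed.

Lemma C4_dec_biadj s t : uniq (s ++ t) -> ~~ odd (size s) -> ~~ odd (size t) ->
  C4_dec (biadj s t).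
Proof.
have [n] := ubnP (size s); elim: n s => // n IH [|a [|b s]] //= sz U evs evt.
  by apply: C4_dec0 => x y; rewrite /biadj !in_nil andbF.
have U' : uniq (t ++ [:: a; b] ++ s) by rewrite uniq_catC.
apply: (@C4_decD _ (biadj [:: a; b] t) (biadj s t)).
- by move=> x y; rewrite -[a :: b :: s]/([:: a; b] ++ s) biadjC biadj_cat //
    !(biadjC t).
- apply: C4_dec_biadj2 => //.
  move: U'; rewrite catA cat_uniq => /andP[U' _].
  by rewrite -[_ :: _ :: t]/([:: a; b] ++ t) uniq_catC.
- apply: IH => //; first by lia.
  + by move: U => /and3P[].
  + by rewrite negbK in evs.
Qed.

End Lists.

(** * Decompositions of tensor products *)

Lemma eq_tensor_sum (T U : Type) (I : Type) (s : seq I)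
    (F : I -> T -> T -> nat) (h : U -> U -> nat) (x y : T * U) :
  tensor (fun a b => \sum_(i <- s) F i a b) h x y
  = \sum_(i <- s) tensor (F i) h x y.
Proof. by rewrite /tensor big_distrl. Qed.

Lemma C4_dec_tensorC (T U : eqType) (r : T -> T -> nat) (h : U -> U -> nat) :
  C4_dec (tensor r h) -> C4_dec (tensor h r).
Proof.
pose f (p : T * U) := (p.2, p.1); pose g (p : U * T) := (p.2, p.1).
move=> /(@C4_dec_pull _ _ _ f g xpredT) D.
apply: eq_C4_dec (D _ _) => // [x y|[a b] [c d] _].
  by rewrite /tensor mulnC.
by rewrite /f /g !xpair_eqE andbC.
Qed.

(** The complete graph on [t] is the edge-disjoint union of its single edges, and [tensor]
    distributes over such unions. *)
Lemma C4_dec_tensor_edges (T U : eqType) (r : T -> T -> nat) (t : seq U) :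
  (forall u v : U, u != v -> C4_dec (tensor r (Kadj [:: u; v]))) ->
  uniq t -> C4_dec (tensor r (Kadj t)).
Proof.
move=> re; elim: t => [|u t IH] Ut.
  by apply: C4_dec0 => x y; rewrite /tensor /Kadj muln0.
have {IH} Dt : C4_dec (tensor r (Kadj t)) by apply: IH; case/andP: Ut.
apply: (@C4_decD _ (tensor r (Kadj t)) (tensor r (biadj [:: u] t))) => //.
  move=> x y; rewrite /tensor -cat1s Kadj_cat // Kadj1; lia.
(* What remains is the star from [u] to [t]; it is split into the edges [[:: u; v]]. *)
elim: t {Dt} Ut => [|v t IH] Ut.
  by apply: C4_dec0 => x y; rewrite /tensor /biadj !in_nil andbF muln0.
have uv : u != v by move: Ut; rewrite /= inE negb_or => /andP[/andP[]].
apply: (@C4_decD _ (tensor r (Kadj [:: u; v])) (tensor r (biadj [:: u] t))).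
- move=> x y; rewrite /tensor -(cat1s v) biadj_cat //.
  by rewrite -[[:: u; v]]/([:: u] ++ [:: v]) Kadj_cat ?Kadj1 /= ?inE ?uv //; lia.
- exact: re.
- apply: IH; move: Ut; rewrite /= inE negb_or.
  by case/andP=> /andP[_ ->] /andP[].
Qed.

Lemma C4_dec_tensor (T U : eqType) (r : T -> T -> nat) (t : seq U) :
  C4_dec r -> uniq t -> C4_dec (tensor r (Kadj t)).
Proof.
move=> [s us sE]; apply: C4_dec_tensor_edges => u v uv.
apply: (@eq_C4_dec _ (fun x y => \sum_(q <- s) tensor (C4_adj q) (Kadj [:: u; v]) x y)).
  by move=> x y; rewrite -eq_tensor_sum /tensor sE.
apply: C4_dec_sum => q /(allP us); case: q => [[[a b] c] d] uq.
(* The cycle is bipartite with sides a, c and b, d. One lifted cycle puts the first side at level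
   [u] and the second at [v]; the other swaps the levels. *)
apply: (@C4_decD _ (C4_adj ((a, u), (b, v), (c, u), (d, v)))
                   (C4_adj ((a, v), (b, u), (c, v), (d, u)))).
- move=> [x u'] [y v']; rewrite /tensor /C4_adj /biadj /Kadj.
  (* Each side of a lifted cycle lies in one level, so membership separates into side and level. *)
  have memE (V W : eqType) (p1 p2 p : V) (w1 w : W) :
      ((p, w) \in [:: (p1, w1); (p2, w1)]) = (p \in [:: p1; p2]) && (w == w1).
    by rewrite !inE !xpair_eqE andb_orl.
  rewrite !memE.
  have dis z := mem_uniq_cat z (etrans (C4_uniq_sides a b c d) uq).
  have := (dis x, dis y) => /=; move: (x \in _) (x \in _) (y \in _) (y \in _).
  rewrite !inE.
  case: (eqVneq u' u) (eqVneq v' u) => [->|u'u] [->|v'u];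
    rewrite ?eqxx ?(negbTE uv) /=; first by do 4!case=> //=; case.
  - by rewrite andbT; case: (v' == v); do 4!case=> //=; case.
  - by rewrite u'u andbT; case: (u' == v); do 4!case=> //=; case.
  - case: (eqVneq u' v) => [->|_]; last by do 4!case=> //=; case.
    by rewrite /= (eq_sym v') andbN; do 4!case=> //=; case.
all: apply: C4_dec1; move: uq; rewrite /= !inE !xpair_eqE !negb_or !negb_and.
all: by case/and4P=> /and3P[-> -> ->] /andP[-> ->] -> _.
Qed.

(** Explicit cycles then need to be given on numbers only. [index] sends a vertex outside the list
    to the size of the list, which is not in [iota], so that such a vertex stays isolated. *)
Lemma C4_dec_transport (T U : eqType) (s : seq T) (t : seq U) :
  uniq s -> uniq t ->
  C4_dec (tensor (Kadj (iota 0 (size s))) (Kadj (iota 0 (size t)))) ->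
  C4_dec (tensor (Kadj s) (Kadj t)).
Proof.
move=> Us Ut.
case: s Us => [|a s] Us; first by move=> _; apply: C4_dec0 => x y.
case: t Ut => [|b t] Ut; first by move=> _; apply: C4_dec0 => x y; rewrite /tensor muln0.
(* The heads [a] and [b] serve as defaults for [nth]; on [A] both indices are in range and no
   default is reached. *)
pose f p := (nth a (a :: s) p.1, nth b (b :: t) p.2).
pose g p := (index p.1 (a :: s), index p.2 (b :: t)).
pose A (p : nat * nat) := (p.1 < size (a :: s)) && (p.2 < size (b :: t)).
have nthE (V : eqType) (v0 : V) w i x : uniq w -> i < size w ->
    (nth v0 w i == x) = (i == index x w).
  move=> Uw iw; apply/eqP/eqP=> [<-|i_x]; first by rewrite index_uniq.
  by rewrite i_x nth_index // -index_mem -i_x.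
have KE (V : eqType) (w : seq V) x y :
    Kadj (iota 0 (size w)) (index x w) (index y w) = Kadj w x y.
  rewrite /Kadj !mem_iota !index_mem /=.
  by case xw: (x \in w); case yw: (y \in w) => //=; rewrite (inj_in_eq (@index_inj V x w)).
move=> /(@C4_dec_pull _ _ _ f g A) D.
apply: eq_C4_dec (D _ _) => // [x y|[i j] [x y] /andP[? ?]|x y].
- by rewrite /tensor !KE.
- by rewrite /f /g !xpair_eqE !nthE.
rewrite /tensor /A muln_gt0 /Kadj !lt0b => /andP[/andP[+ _] /andP[+ _]].
by rewrite !mem_iota /= => -> ->.
Qed.

(** * Explicit decompositions of K_5 x K_2 and K_4 x K_3 *)

Lemma C4_dec_K5K2 : C4_dec (tensor (Kadj (iota 0 5)) (Kadj (iota 0 2))).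
Proof.
exists [:: ((0, 1), (2, 0), (1, 1), (3, 0)); ((0, 1), (1, 0), (2, 1), (4, 0));
           ((0, 0), (1, 1), (4, 0), (3, 1)); ((1, 0), (3, 1), (2, 0), (4, 1));
           ((0, 0), (2, 1), (3, 0), (4, 1))] => // x y.
(* Unlocking the big operator lets the sum compute. In the case analysis, the last case of each
   coordinate covers all values out of range, where there are no edges. *)
rewrite unlock; case: x y => [x u] [y v].
by case: x => [|[|[|[|[|x]]]]]; case: y => [|[|[|[|[|y]]]]];
   case: u => [|[|u]]; case: v => [|[|v]].
Qed.

(** The second factor is a triangle because K_4 x K_2 is 3-regular, hence not decomposable: here one
    cannot proceed edge by edge as with K_5. *)
Lemma C4_dec_K4K3 : C4_dec (tensor (Kadj (iota 0 4)) (Kadj (iota 0 3))).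
Proof.
exists [:: ((0, 0), (1, 1), (2, 0), (1, 2)); ((0, 1), (2, 2), (1, 1), (3, 0));
           ((0, 1), (1, 0), (2, 1), (3, 2)); ((0, 1), (1, 2), (3, 1), (2, 0));
           ((0, 0), (2, 1), (3, 0), (2, 2)); ((0, 0), (3, 1), (1, 0), (3, 2));
           ((0, 2), (1, 1), (3, 2), (2, 0)); ((0, 2), (1, 0), (2, 2), (3, 1));
           ((0, 2), (2, 1), (1, 2), (3, 0))] => // x y.
rewrite unlock; case: x y => [x u] [y v].
by case: x => [|[|[|[|x]]]]; case: y => [|[|[|[|y]]]];
   case: u => [|[|[|u]]]; case: v => [|[|[|v]]].
Qed.

(** * Sufficiency: complete graphs of order 1 or 0 mod 4 as a factor *)

Section Complete.
Variables T U : eqType.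

Lemma C4_dec_tensor_r (s : seq T) (h : U -> U -> nat) :
  uniq s -> C4_dec h -> C4_dec (tensor (Kadj s) h).
Proof. by move=> Us Dh; apply/C4_dec_tensorC/C4_dec_tensor. Qed.

(** A K_5 on the first five vertices is glued at [c] to the clique on [c :: s], whose order is
    smaller by 4. The edges left over form K_{4,|s|} with 4 dividing |s|. The K_5 part reduces to
    K_5 x K_2. *)
Lemma C4_dec_K_1mod4 (s : seq T) (t : seq U) :
  uniq s -> uniq t -> size s = 1 %[mod 4] -> C4_dec (tensor (Kadj s) (Kadj t)).
Proof.
move=> + Ut; have [n] := ubnP (size s); elim: n s => // n IH.
case=> [|a [|b [|d [|e [|c s]]]]] // sz Us s1.
  by apply: C4_dec0 => x y; rewrite /tensor Kadj1.
have [Up Ups Ucs] := uniq_glue (Us : uniq ([:: a; b; d; e] ++ c :: s)).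
apply: (@C4_decD _ (tensor (Kadj [:: a; b; d; e; c]) (Kadj t))
   (tensor (fun x y => biadj [:: a; b; d; e] s x y + Kadj (c :: s) x y)
     (Kadj t))).
- by move=> x y; rewrite /tensor -mulnDl addnA -Kadj_glue.
- apply: C4_dec_tensor_edges => // u v uv; apply: C4_dec_transport.
  + exact: Up.
  + by rewrite /= inE uv.
  + exact: C4_dec_K5K2.
- apply: (@C4_decD _ (tensor (biadj [:: a; b; d; e] s) (Kadj t))
                     (tensor (Kadj (c :: s)) (Kadj t))).
  + by move=> x y; rewrite /tensor -mulnDl.
  + apply: C4_dec_tensor => //; apply: C4_dec_biadj => //.
    by move: s1 => /=; lia.
  + apply: IH; [by move: sz => /=; lia | by [] | by move: s1 => /=; lia].
Qed.

(** A triangle is glued at [c] to the clique on the rest of [t], whose order is smaller by 2. Since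
    |t| is odd, the edges left over form a complete bipartite graph with even sides. *)
Lemma C4_dec_K4_odd (p : seq T) (t : seq U) :
  uniq p -> size p = 4 -> uniq t -> odd (size t) ->
  C4_dec (tensor (Kadj p) (Kadj t)).
Proof.
move=> Up p4; have [n] := ubnP (size t); elim: n t => // n IH.
case=> [|a [|b [|c t]]] // sz Ut ot.
  by apply: C4_dec0 => x y; rewrite /tensor Kadj1 muln0.
have [Uabc Uabt Uct] := uniq_glue (Ut : uniq ([:: a; b] ++ c :: t)).
apply: (@C4_decD _ (tensor (Kadj p) (Kadj [:: a; b; c]))
   (tensor (Kadj p) (fun x y => biadj [:: a; b] t x y + Kadj (c :: t) x y))).
- by move=> x y; rewrite /tensor -mulnDr addnA -Kadj_glue.
- apply: C4_dec_transport => //; rewrite p4; exact: C4_dec_K4K3.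
- apply: (@C4_decD _ (tensor (Kadj p) (biadj [:: a; b] t))
                     (tensor (Kadj p) (Kadj (c :: t)))).
  + by move=> x y; rewrite /tensor -mulnDr.
  + apply: C4_dec_tensor_r => //; apply: C4_dec_biadj => //.
    by move: ot => /=; lia.
  + apply: IH; [by move: sz => /=; lia | by [] | by move: ot => /=; lia].
Qed.

(** Here the K_4 that is split off is disjoint from the rest: gluing at a vertex would not preserve
    the residue 0 mod 4. The edges between the two parts form a bipartite graph with sides divisible
    by 4. *)
Lemma C4_dec_K_0mod4_odd (s : seq T) (t : seq U) :
  uniq s -> uniq t -> size s = 0 %[mod 4] -> odd (size t) ->
  C4_dec (tensor (Kadj s) (Kadj t)).
Proof.
move=> + Ut + ot; have [n] := ubnP (size s); elim: n s => // n IH.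
case=> [|a [|b [|d [|e s]]]] // sz Us s0; first exact: C4_dec0.
have [Up _ Us'] := and3P (etrans (esym (cat_uniq [:: a; b; d; e] s)) Us).
apply: (@C4_decD _ (tensor (Kadj [:: a; b; d; e]) (Kadj t))
   (tensor (fun x y => Kadj s x y + biadj [:: a; b; d; e] s x y)
     (Kadj t))).
- by move=> x y; rewrite /tensor -mulnDl addnA -Kadj_cat.
- exact: C4_dec_K4_odd.
- apply: (@C4_decD _ (tensor (Kadj s) (Kadj t))
                     (tensor (biadj [:: a; b; d; e] s) (Kadj t))).
  + by move=> x y; rewrite /tensor -mulnDl.
  + by apply: IH => //; move: sz s0 => /=; lia.
  + apply: C4_dec_tensor => //; apply: C4_dec_biadj => //.
    move: s0 => /=; lia.
Qed.

End Complete.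

(** * Partitions of an edge set versus lists of 4-cycles *)

Lemma eq_set2 (T : finType) (x y a b : T) : ([set x; y] == [set a; b])
  = (x == a) && (y == b) || (x == b) && (y == a).
Proof.
apply/eqP/idP => [e|/orP[] /andP[/eqP-> /eqP->] //]; last exact: setUC.
have ax : a \in [set x; y] by rewrite e set21.
have bx : b \in [set x; y] by rewrite e set22.
have xa : x \in [set a; b] by rewrite -e set21.
have ya : y \in [set a; b] by rewrite -e set22.
move: ax bx xa ya; rewrite !inE ![a == _]eq_sym ![b == _]eq_sym.
by move: (x == a) (x == b) (y == a) (y == b); do 4!case.
Qed.

Section Decomposition.
Variable G : sgraph.

Definition C4_edges (q : G * G * G * G) : {set {set G}} :=
  let: (a, b, c, d) := q in
  [set [set a; b]; [set b; c]; [set c; d]; [set d; a]].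

Lemma mem_edges (x y : G) : ([set x; y] \in edges G) = adj x y.
Proof.
apply/imsetP/idP => [[[a b] /[!inE] /= ab /eqP]|xy]; last by exists (x, y); rewrite ?inE.
by rewrite eq_set2 => /orP[] /andP[/eqP-> /eqP->] //; rewrite adj_sym.
Qed.

Lemma edgesP (e : {set G}) :
  reflect (exists x y, adj x y /\ e = [set x; y]) (e \in edges G).
Proof.
apply: (iffP idP) => [/imsetP[[x y] /[!inE] xy ->]|[x [y [xy ->]]]].
  by exists x, y.
by rewrite mem_edges.
Qed.

Lemma mem_C4_edges q (x y : G) : ([set x; y] \in C4_edges q) = C4_adj q x y.
Proof.
case: q => [[[a b] c] d]; rewrite !inE !eq_set2 /= /biadj !inE.
move: (x == a) (x == b) (x == c) (x == d) (y == a) (y == b) (y == c) (y == d).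
by do 8!case.
Qed.

Lemma subgraph_C4 (S : subgraph G) : subgraph_iso S (cycle_graph 4) ->
  exists2 q, C4_uniq q & sub_edges S = C4_edges q.
Proof.
case=> f [fI fV fE].
pose o i (h : i < 4) : cycle_graph 4 := Ordinal h.
pose a := f (@o 0 isT); pose b := f (@o 1 isT).
pose c := f (@o 2 isT); pose d := f (@o 3 isT).
exists (a, b, c, d); first by rewrite /= !inE !(inj_eq fI).
have fP x : x \in sub_vertices S -> x \in [:: a; b; c; d].
  rewrite -fV => /imsetP[[[|[|[|[|//]]]] h] _ ->]; rewrite (bool_irrelevance h isT);
  by rewrite !inE eqxx ?orbT.
(* The edge sets agree on pairs taken from the four vertices; this suffices, since every edge on
   either side is such a pair. *)
have qE x y : x \in [:: a; b; c; d] -> y \in [:: a; b; c; d] ->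
    ([set x; y] \in sub_edges S) = ([set x; y] \in C4_edges (a, b, c, d)).
  rewrite mem_C4_edges !inE.
  by case/or4P=> /eqP->; case/or4P=> /eqP->; rewrite -fE /= /biadj !inE !(inj_eq fI).
apply/setP=> e; apply/idP/idP => eS.
  have /subsetP/(_ _ eS)/edgesP[x [y [xy e_xy]]] := sub_edges_edges S.
  have /subsetP sV := sub_edges_vertices eS.
  by move: eS; rewrite e_xy qE //; apply/fP/sV; rewrite e_xy !inE eqxx ?orbT.
move: (eS); rewrite !inE -!orbA => /or4P[] /eqP ee; rewrite ee qE ?inE ?eqxx ?orbT -?ee //.
Qed.

Lemma C4_subgraph q : C4_uniq q -> C4_edges q \subset edges G ->
  exists2 S : subgraph G, subgraph_iso S (cycle_graph 4) & sub_edges S = C4_edges q.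
Proof.
case: q => [[[a b] c] d] uq qG.
have qV e : e \in C4_edges (a, b, c, d) -> e \subset [set x in [:: a; b; c; d]].
  rewrite !inE -!orbA => /or4P[] /eqP->; apply/subsetP=> x;
  by rewrite !inE => /orP[] ->; rewrite ?orbT.
exists (Subgraph qG qV) => //.
(* The default [a] is never reached, as [i < 4]. *)
exists (fun i : 'I_4 => nth a [:: a; b; c; d] i); split.
- move=> i j /eqP; rewrite nth_uniq // => /eqP ij; exact: val_inj.
- apply/setP=> x; apply/imsetP/idP => [[i _ ->]|].
    by rewrite inE mem_nth.
  rewrite inE => xq; have := xq; rewrite -index_mem => h.
  by exists (Ordinal h); rewrite //= nth_index.
- move=> i j; rewrite (mem_C4_edges (a, b, c, d)).
  move: uq; rewrite /= !inE !negb_or => /and4P[/and3P[ab ac ad] /andP[bc bd] cd _].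
  case: i j => [[|[|[|[|//]]]] hi] [[|[|[|[|//]]]] hj];
  rewrite /adj /= /cycle_adj /= /biadj !inE ?[b == a]eq_sym ?[c == a]eq_sym ?[d == a]eq_sym
    ?[c == b]eq_sym ?[d == b]eq_sym ?[d == c]eq_sym ?eqxx
    ?(negbTE ab, negbTE bc, negbTE cd, negbTE ad, negbTE ac, negbTE bd) //.
Qed.

(** Adjacency in a simple graph is a multiplicity of at most 1, so a list of cycles that sums to it
    is automatically edge-disjoint. Conversely, the blocks of a partition are disjoint, so their
    indicators add up to that of the edge set. *)
Lemma C4_decP : cycle_decomposition 4 G <-> C4_dec (@adj G).
Proof.
split=> [[P [Pp PC]]|[s us sE]].
  have [/eqP Pcov Ptr _] := and3P Pp.
  apply: (@eq_C4_dec _ (fun x y => \sum_(B <- enum P) ([set x; y] \in B))).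
    move=> x y; rewrite -mem_edges -Pcov big_enum.
    (* Written as a sum over the members of the set, the indicator can be split along the blocks by
       [big_trivIset]. *)
    have memE (A : {set {set G}}) e : (e \in A : nat) = \sum_(z in A) (z == e).
      have [eA|eA] := boolP (e \in A).
        by rewrite (bigD1 e) //= eqxx big1 // => z /andP[_ /negbTE->].
      by rewrite big1 // => z zA; case: eqP zA eA => // -> ->.
    rewrite memE big_trivIset //; apply: eq_bigr => B _; exact: memE.
  apply: C4_dec_sum => B; rewrite mem_enum => /PC[S /subgraph_C4[q uq qS] <-].
  apply: eq_C4_dec (C4_dec1 uq) => x y.
  by rewrite qS mem_C4_edges.
have sG q : q \in s -> C4_edges q \subset edges G.
  move=> qs; have qr x y : C4_adj q x y -> adj x y.
    by move/(C4_adj_support sE qs); rewrite lt0b.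
  have := C4_adj_edges q; case: q {qs} qr => [[[a b] c] d] qr.
  case/and4P=> /qr ab /qr bc /qr cd /qr da.
  by apply/subsetP=> e; rewrite !inE -!orbA => /or4P[] /eqP->; rewrite mem_edges.
exists [set B in map C4_edges s]; split; last first.
  move=> B; rewrite inE => /mapP[q qs ->].
  by apply: C4_subgraph; [exact: (allP us) | exact: sG].
apply/and3P; split.
- apply/eqP/setP=> e; apply/bigcupP/idP => [[B]|/edgesP[x [y [xy ->]]]].
    by rewrite inE => /mapP[q qs ->]; apply/subsetP/sG.
  have : 0 < \sum_(q <- s) C4_adj q x y by rewrite sE xy.
  rewrite lt0n sum_nat_seq_neq0 => /hasP[q qs /=]; rewrite eqb0 negbK => qxy.
  by exists (C4_edges q); rewrite ?mem_C4_edges // inE map_f.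
- apply/trivIsetP=> _ _ /[!inE] /mapP[q qs ->] /mapP[q' qs' ->] qq'.
  apply/pred0P=> e /=; apply/negP=> /andP[eq eq'].
  have /edgesP[x [y [xy e_xy]]] := subsetP (sG _ qs) _ eq.
  (* Two different blocks through one edge would contribute 2 to a multiplicity equal to 1. *)
  have := sE x y; rewrite xy (big_rem q) // (big_rem q') /=; last first.
    move: qs'; rewrite (perm_mem (perm_to_rem qs)) inE => /orP[/eqP q'q|//].
    by rewrite q'q eqxx in qq'.
  by rewrite -!mem_C4_edges -e_xy eq eq'.
- rewrite inE; apply/mapP=> -[[[[a b] c] d] _ /setP/(_ [set a; b])].
  by rewrite !inE eqxx.
Qed.

End Decomposition.

(** * Necessity: degrees and edge counts *)

Lemma sum_mem_uniq (T : finType) (s : seq T) :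
  uniq s -> \sum_x (x \in s) = size s.
Proof. by move=> Us; rewrite -(card_uniqP Us) -sum1_card [RHS]big_mkcond. Qed.

(** The neighbours of a vertex on the cycle are the two vertices of the opposite side of K_{2,2}. *)
Lemma sum_C4_adj (T : finType) (q : T * T * T * T) x : C4_uniq q ->
  \sum_y C4_adj q x y = 2 * (let: (a, b, c, d) := q in x \in [:: a; b; c; d]).
Proof.
case: q => [[[a b] c] d] uq.
rewrite -C4_uniq_sides in uq; have dis := mem_uniq_cat x uq.
have /and3P[ac _ bd] := etrans (esym (cat_uniq _ _)) uq.
rewrite (eq_bigr (fun y => (x \in [:: a; c]) * (y \in [:: b; d])
                        + (x \in [:: b; d]) * (y \in [:: a; c]))); last first.
  move=> y _; rewrite /= /biadj; move: dis.
  by do 4!case: (_ \in _).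
rewrite big_split /= -!big_distrr /= !sum_mem_uniq // -mulnDl mulnC; congr (2 * _).
move: dis; rewrite !inE.
by move: (x == a) (x == b) (x == c) (x == d); do 4!case.
Qed.

Section Necessity.
Variables m n : nat.
Let KmKn := tensor_product (complete_graph m) (complete_graph n).

Lemma sum_neq k (x : 'I_k) : \sum_y (x != y) = k.-1.
Proof.
have := cardC1 x; rewrite card_ord => <-; rewrite -sum1_card [RHS]big_mkcond.
by apply: eq_bigr => y _; rewrite inE /= eq_sym; case: (y == x).
Qed.

Lemma tensor_degree (x : 'I_m * 'I_n) : \sum_y @adj KmKn x y = m.-1 * n.-1.
Proof.
rewrite -(sum_neq x.1) -(sum_neq x.2) big_distrlr pair_big.
by apply: eq_bigr => y _; apply/esym/mulnb.
Qed.

(** Each cycle contributes 0 or 2 to the degree of a fixed vertex; positivity of [m] and [n]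
    provides that vertex. *)
Lemma C4_dec_degree :
  C4_dec (@adj KmKn) -> 0 < m -> 0 < n -> ~~ odd (m.-1 * n.-1).
Proof.
move=> [s us sE] m0 n0.
rewrite -(tensor_degree (Ordinal m0, Ordinal n0)) -dvdn2.
under eq_bigr => y _ do rewrite -sE.
rewrite exchange_big big_seq; apply: dvdn_sum => q /(allP us) uq.
by rewrite sum_C4_adj // dvdn_mulr.
Qed.

(** The degree sum counts every edge twice, so each 4-cycle contributes 8 to it. *)
Lemma C4_dec_size : C4_dec (@adj KmKn) -> 8 %| m * n * (m.-1 * n.-1).
Proof.
case=> s us sE.
have -> : m * n * (m.-1 * n.-1) = \sum_x \sum_y @adj KmKn x y.
  rewrite (eq_bigr _ (fun x _ => tensor_degree x)).
  by rewrite sum_nat_const card_prod !card_ord.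
under eq_bigr => x _ do (under eq_bigr => y _ do rewrite -sE).
under eq_bigr => x _ do rewrite exchange_big.
rewrite exchange_big big_seq; apply: dvdn_sum => q /(allP us) uq /=.
under eq_bigr => x _ do rewrite sum_C4_adj //.
rewrite -big_distrr /= (@dvdn_pmul2l 2 4) //.
case: q uq => [[[a b] c] d] uq.
by rewrite sum_mem_uniq.
Qed.

End Necessity.

(** * Residue arithmetic and the characterization *)

Lemma mod4_cases m n : 0 < m -> 0 < n ->
  ~~ odd (m.-1 * n.-1) -> 8 %| m * n * (m.-1 * n.-1) ->
  [\/ n = 0 %[mod 4] /\ odd m,
      m = 0 %[mod 4] /\ odd n
    | m = 1 %[mod 4] \/ n = 1 %[mod 4]].
Proof.
case: m n => // m [] // n _ _ /=; rewrite /dvdn.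
(* From here [m] and [n] denote the predecessors of the original numbers. Both hypotheses and the
   conclusion depend only on their residues mod 8, which leaves 64 pairs to check. *)
have S8 p : (p %% 8).+1 = p.+1 %[mod 8] by rewrite -addn1 modnDml addn1.
rewrite -modnMm -(modnMm m.+1) -(modnMm m n) -(S8 m) -(S8 n).
rewrite (_ : m.+1 %% 4 = (m %% 8).+1 %% 4); last by lia.
rewrite (_ : n.+1 %% 4 = (n %% 8).+1 %% 4); last by lia.
rewrite oddM (_ : odd m = odd (m %% 8)); last by lia.
rewrite (_ : odd n = odd (n %% 8)); last by lia.
have := ltn_pmod n (isT : 0 < 8); have := ltn_pmod m (isT : 0 < 8).
move: (m %% 8) (n %% 8).
case=> [|[|[|[|[|[|[|[|//]]]]]]]]; case=> [|[|[|[|[|[|[|[|//]]]]]]]] => //= _ _ _ _;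
  by [apply: Or31 | apply: Or32 | apply: Or33; left | apply: Or33; right].
Qed.

Theorem theorem1p1 (m n : nat) (hm : 2 <= m) (hn : 2 <= n) :
  cycle_decomposition 4 (tensor_product (complete_graph m) (complete_graph n))
  <->
  [\/ n = 0 %[mod 4] /\ odd m,
      m = 0 %[mod 4] /\ odd n
    | m = 1 %[mod 4] \/ n = 1 %[mod 4]].
Proof.
have [m0 n0] : 0 < m /\ 0 < n by lia.
rewrite C4_decP; split=> [D|mn].
  by apply: mod4_cases => //; [apply: C4_dec_degree | apply: C4_dec_size].
(* The ordinals are listed by [enum], which brings the graph into the form of the list lemmas. *)
suff D : C4_dec (tensor (Kadj (enum 'I_m)) (Kadj (enum 'I_n))).
  apply: eq_C4_dec D => x y.
  by rewrite /tensor /Kadj !mem_enum mulnb.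
have [Um Un] := (enum_uniq 'I_m, enum_uniq 'I_n).
have [sm sn] := (size_enum_ord m, size_enum_ord n).
(* The first and last cases follow from the other two by exchanging the tensor factors. *)
case: mn => [[n4 om]|[m4 on]|[m1|n1]].
- by apply/C4_dec_tensorC/C4_dec_K_0mod4_odd; rewrite ?sm ?sn.
- by apply/C4_dec_K_0mod4_odd; rewrite ?sm ?sn.
- by apply/C4_dec_K_1mod4; rewrite ?sm ?sn.
- by apply/C4_dec_tensorC/C4_dec_K_1mod4; rewrite ?sm ?sn.
Qed.
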